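(* Let $X,Y$ be real Banach spaces and let $f\in C^1(X;Y)$. Assume: (i) $f'(x)\in \mathrm{Isom}(X;Y)$ for every $x\in X$; (ii) $\sup_{\|x\|\le r}\|f'(x)^{-1}\|<+\infty$ for every $r$ with $0<r<+\infty$; (iii) there exist a point $x_0\in X$ and a locally Lipschitz continuous coercive function $k:X\to\mathbb{R}_+$ which admits all right directional derivatives $D^+_v k(x)$ ($x,v\in X$), such that $$\sup\bigl\{D^+_v k(x) : v=-f'(x)^{-1}(f(x)-f(x_0)),\ x\in X\bigr\}<+\infty.$$ Then $f$ is a global diffeomorphism $X\to f(X)$ (in particular $f$ is injective). Moreover, the range $f(X)$ is star shaped around $f(x_0)$: if $y\in f(X)$ and $s\in[0,1]$, then $f(x_0)+s(y-f(x_0))\in f(X)$. When $k\in C^1$, condition (iii) reads $$\sup_{x\in X}\bigl(-k'(x)f'(x)^{-1}(f(x)-f(x_0))\bigr)<+\infty.$$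
   Context: $\mathrm{Isom}(X;Y)$ denotes the set of bounded linear isomorphisms (with bounded inverse) from $X$ onto $Y$. $\mathbb{R}_+=[0,+\infty)$. A function $k:X\to\mathbb{R}_+$ is called coercive if it is continuous and $k(x)\to+\infty$ as $\|x\|\to+\infty$. The right directional derivative is $D^+_v k(x):=\lim_{s\to 0^+}\frac{k(x+sv)-k(x)}{s}$, assumed to exist for all $x,v\in X$. *)

(* Defs.v *)
From HB Require Import structures.
From mathcomp Require Import all_boot all_order all_algebra.
From mathcomp Require Import all_classical all_reals all_analysis.
Set Implicit Arguments. Unset Strict Implicit. Unset Printing Implicit Defensive.
Import Order.TTheory GRing.Theory Num.Theory.
Import numFieldNormedType.Exports.
Local Open Scope classical_set_scope.
Local Open Scope ring_scope.

Definition opnorm (R : realType) (V W : normedModType R) (L : V -> W) : R :=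
  sup [set `|L v| | v in [set v : V | `|v| <= 1]].

Definition is_isom (R : realType) (V W : normedModType R) (L : {linear V -> W}) :=
  continuous L /\
  exists g : {linear W -> V}, [/\ cancel L g, cancel g L & continuous g].

(* The (two-sided) inverse map of L, chosen classically (meaningful when L
   is bijective). *)
Definition inv_map (R : realType) (V W : normedModType R) (L : V -> W) : W -> V :=
  get (fun g : W -> V => cancel L g /\ cancel g L).

Definition C1 (R : realType) (V W : normedModType R) (f : V -> W) :=
  (forall x, differentiable f x) /\
  (forall x, (fun z => opnorm ('d f z \- 'd f x)) @ x --> (0 : R)).

Definition C1_on (R : realType) (V W : normedModType R) (A : set V) (g : V -> W) :=
  (forall y, A y -> differentiable g y) /\
  (forall y, A y -> (fun z => opnorm ('d g z \- 'd g y)) @ y --> (0 : R)).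

Definition rdirder (R : realType) (V : normedModType R) (k : V -> R) (x v : V) : R :=
  lim ((fun s : R => (k (x + s *: v) - k x) / s) @ 0^'+).

Definition has_rdirder (R : realType) (V : normedModType R) (k : V -> R) :=
  forall x v : V, cvg ((fun s : R => (k (x + s *: v) - k x) / s) @ 0^'+).

Definition coercive (R : realType) (V : normedModType R) (k : V -> R) :=
  continuous k /\
  (forall M : R, exists r : R, forall x : V, r <= `|x| -> M <= k x).

Definition locally_lipschitz (R : realType) (V W : normedModType R) (k : V -> W) :=
  forall x : V, exists2 e : R, 0 < e &
    exists L : R, forall y z, `|y - x| < e -> `|z - x| < e ->
      `|k y - k z| <= L * `|y - z|.

Definition global_diffeo_onto_range (R : realType) (V W : normedModType R) (f : V -> W) :=
  [/\ injective f, open (range f) &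
      exists g : W -> V, (forall x, g (f x) = x) /\ C1_on (range f) g].

(* Main.v *)
Require Import Defs.
From HB Require Import structures.
From mathcomp Require Import all_boot all_order all_algebra.
From mathcomp Require Import all_classical all_reals all_analysis.
From mathcomp Require Import ring lra.
Set Implicit Arguments. Unset Strict Implicit. Unset Printing Implicit Defensive.
Import Order.TTheory GRing.Theory Num.Theory.
Import numFieldNormedType.Exports.
Local Open Scope classical_set_scope.
Local Open Scope ring_scope.

(* Put F = f - f x0.  Call Z a chart if it is open, contains x0, F is injective
   on Z and F(Z) is star-shaped about 0.  As f is a local homeomorphism, lifts of
   rays are unique, so the union of all charts is the largest chart.  It is
   closed: let x be a limit of points z of it.  Traversed towards x0, the lift of
   the ray s F(z) has velocity a multiple 1/s of - f'^-1 F, so condition (iii)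
   and right Dini derivatives bound k by k(z) + |M|/c on the part c <= s <= 1;
   for s < c the lift stays in a fixed bounded chart.  By coercivity the lifts are
   bounded uniformly in z, hence uniformly Lipschitz by condition (ii), and they
   converge to a lift ending at x.  The largest chart is thus clopen, hence the
   whole space. *)

(** * Real induction and mean value inequalities on an interval *)

(** At the supremum of the [t] up to which [P] holds throughout, the last hypothesis gives [P], and
    the one before it carries [P] further unless that supremum is [b]. *)
Lemma real_induction (R : realType) (a b : R) (P : R -> Prop) :
  a <= b -> P a ->
  (forall t, a <= t < b -> P t -> \forall s \near t^'+, P s) ->
  (forall t, a < t <= b -> (forall s, a <= s < t -> P s) -> P t) ->
  forall t, a <= t <= b -> P t.
Proof.
move=> leab Pa Popen Pclosed.
pose S : set R := [set t | a <= t <= b /\ forall s, a <= s <= t -> P s].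
have Sa : S a.
  by split=> [|s sa]; rewrite ?lexx ?leab// (_ : s = a) //; lra.
have supS : has_sup S.
  by split; [exists a | exists b => t [/andP[_ ?] _]].
have ac : a <= sup S by apply: ub_le_sup => //; exact: supS.2.
have cb : sup S <= b by apply: ge_sup => [|t [/andP[_ ?] _]//]; exists a.
have Plt s : a <= s < sup S -> P s.
  move=> /andP[as_ sc]; have [t [tab tP] st] := sup_gt supS.1 sc.
  by apply: tP; rewrite as_ ltW.
have Pc : P (sup S).
  have [<-//|ac'] := eqVneq a (sup S).
  by apply: Pclosed => //; rewrite lt_neqAle ac' ac cb.
have Ple s : a <= s <= sup S -> P s.
  move=> /andP[as_]; rewrite le_eqVlt => /orP[/eqP->//|sc].
  by apply: Plt; rewrite as_ sc.
suff cE : sup S = b by move=> t; rewrite -cE => /Ple.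
apply/eqP; rewrite eq_le cb leNgt; apply/negP => ltcb.
have [|d /= d0 dP] := Popen (sup S) _ Pc; first by rewrite ac.
(* [u] lies beyond [sup S], yet inside the interval and within the radius [d] on which [P] is
   known. *)
pose u := Num.min b (sup S + d / 2).
have cu : sup S < u by rewrite /u lt_min ltcb/= ltrDl divr_gt0.
suff Su : S u by have := ub_le_sup (proj2 supS) Su; rewrite leNgt cu.
have ub : u <= b by rewrite /u ge_min lexx.
have ud : u <= sup S + d / 2 by rewrite /u ge_min lexx orbT.
split=> [|s /andP[as_ su]]; first by rewrite ub (le_trans ac (ltW cu)).
have [sc|cs] := leP s (sup S); first by apply: Ple; rewrite as_.
apply: dP => //=; rewrite ltr0_norm ?subr_lt0//; lra.
Qed.

(** The affine bound of slope [M + c] extends to the right by the Dini hypothesis and survives left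
    limits by continuity; the excess [c] is then absorbed. *)
Lemma right_dini_le (R : realType) (u : R -> R) (a b M : R) :
  a <= b -> 0 <= M -> (forall t, a <= t <= b -> {for t, continuous u}) ->
  (forall t, a <= t < b -> forall e, 0 < e ->
    \forall s \near t^'+, u s <= u t + (M + e) * (s - t)) ->
  u b <= u a + M * (b - a).
Proof.
move=> leab M0 ucont uM; apply/ler_addgt0Pr => e e0.
(* Chosen so that [c * (b - a) <= e]; the [+ 1] keeps the denominator positive when [a = b]. *)
pose c := e / (b - a + 1).
have c0 : 0 < c by rewrite divr_gt0//; lra.
suff P t : a <= t <= b -> u t <= u a + (M + c) * (t - a).
  have := P b; rewrite leab lexx => /(_ isT) /le_trans; apply.
  rewrite mulrDl addrA lerD2l /c -mulrA ler_piMr ?(ltW e0)//.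
  by rewrite mulrC ler_pdivrMr; lra.
apply: (real_induction (P := fun t => u t <= u a + (M + c) * (t - a))) => //.
- by rewrite subrr mulr0 addr0.
- move=> r rab Pr; have {}uM := uM r rab c c0; near=> s.
  have : u s <= u r + (M + c) * (s - r) by near: s.
  by move=> /le_trans; apply; lra.
- move=> r /andP[ar rb] Pr; apply/ler_addgt0Pr => d d0.
  have := ucont r; rewrite rb ltW// => /(_ isT) /cvgrPdist_le /(_ d d0) ucr.
  near r^'- => s.
  have sr : s < r by near: s; exact: nbhs_left_lt.
  have as_ : a <= s by near: s; exact: nbhs_left_ge.
  have := Pr s; rewrite as_ sr => /(_ isT) Ps.
  have : `|u r - u s| <= d by near: s; exact: cvg_within ucr.
  move=> /ler_normlP[_ urs].
  have : (M + c) * (s - a) <= (M + c) * (r - a) by rewrite ler_wpM2l//; lra.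
  lra.
Unshelve. all: end_near. Qed.

(** [right_dini_le] applied to the distance from [h a]. Only pointwise growth rates enter, which
    suits lifts of rays as well as [f] along segments. *)
Lemma mean_value_le (R : realType) (V : normedModType R) (h : R -> V)
    (a b C : R) :
  a <= b -> 0 <= C ->
  (forall t, a <= t <= b -> forall e, 0 < e ->
    \forall s \near t, `|h s - h t| <= (C + e) * `|s - t|) ->
  `|h b - h a| <= C * (b - a).
Proof.
move=> leab C0 hC.
have := @right_dini_le _ (fun t => `|h t - h a|) a b C leab C0.
rewrite subrr normr0 add0r; apply.
- move=> t /hC /(_ 1 ltr01) hCt; apply: cvg_norm.
  apply: cvgB; last exact: cvg_cst.
  apply/cvgrPdist_le => e e0; near=> s.
  rewrite distrC; apply: (@le_trans _ _ ((C + 1) * `|s - t|)).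
    by near: s.
  rewrite -ler_pdivlMl; last lra.
  near: s; exists ((C + 1)^-1 * e) => [|s /=]; last by rewrite distrC => /ltW.
  by rewrite /= mulr_gt0// invr_gt0; lra.
- move=> t /andP[at_ tb] e e0.
  have := hC t; rewrite at_ ltW// => /(_ isT e e0) hCt; near=> s.
  have ts : t < s by near: s; exact: nbhs_right_gt.
  rewrite -[h s](subrK (h t)) -addrA addrC.
  apply: (le_trans (ler_normD _ _)); rewrite lerD2l.
  rewrite -[X in _ * X]ger0_norm ?subr_ge0 ?(ltW ts)//.
  by near: s; exact: cvg_within hCt.
Unshelve. all: end_near. Qed.

(** * Local inverses, lifts of rays, and charts *)

Section Branches.
Context {R : realType} {V W : normedModType R}.
Variables (F : V -> W) (x0 : V).

Definition inj_on (U : set V) := forall x y, U x -> U y -> F x = F y -> x = y.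

(** The inverse of [F] on [U], picked classically: arbitrary outside the image of [U], and
    unambiguous on it once [F] is injective on [U]. *)
Definition branch (U : set V) (y : W) : V := get (fun x => U x /\ F x = y).

Hypothesis F0 : F x0 = 0.
Hypothesis Fcont : continuous F.
Hypothesis Finj : forall x, \forall e \near 0^'+, inj_on (ball x e).
Hypothesis Fopen : forall x U, nbhs x U -> nbhs (F x) (F @` U).

Lemma branchP U y : (F @` U) y -> U (branch U y) /\ F (branch U y) = y.
Proof. by move=> [x Ux Fx]; apply: (getPex (P := fun x => U x /\ F x = y)); exists x. Qed.

Lemma branchK U x : inj_on U -> U x -> branch U (F x) = x.
Proof.
move=> injU Ux; have [|Ub Fb] := @branchP U (F x); first by exists x.
exact: injU.
Qed.

Lemma branch_cvg U x : inj_on U -> open U -> U x -> branch U @ F x --> x.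
Proof.
move=> injU opU Ux A Ax.
have : nbhs (F x) (F @` (A `&` U)).
  by apply: Fopen; apply: filterI => //; exact: open_nbhs_nbhs.
by apply: filterS => _ [z [Az Uz] <-] /=; rewrite branchK.
Qed.

Lemma branch_continuous U y : inj_on U -> open U -> (F @` U) y ->
  {for y, continuous (branch U)}.
Proof.
move=> injU opU [x Ux <-].
by rewrite /prop_for /continuous_at branchK//; exact: branch_cvg.
Qed.

Lemma branch_ray_continuous U y t : inj_on U -> open U -> (F @` U) (t *: y) ->
  {for t, continuous (fun s : R => branch U (s *: y))}.
Proof.
move=> injU opU Uy; apply: (@continuous_comp R W V ( *:%R^~ y) (branch U)).
  exact: scalel_continuous.
exact: branch_continuous.
Qed.

(** Agreement passes to the right by local injectivity near [p t], and to left limits by uniqueness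
    of limits. *)
Lemma lift_unique (p q : R -> V) a b : a <= b ->
  (forall t, a <= t <= b -> {for t, continuous p}) ->
  (forall t, a <= t <= b -> {for t, continuous q}) ->
  (forall t, a <= t <= b -> F (p t) = F (q t)) ->
  p a = q a -> p b = q b.
Proof.
move=> leab pc qc Fpq pqa.
have := @real_induction R a b (fun t => p t = q t) leab pqa.
move=> /(_ _ _ b); rewrite leab lexx; apply=> // t.
- move=> /andP[at_ tb] pqt; have tab : a <= t <= b by rewrite at_ ltW.
  near (0 : R)^'+ => e.
  have e0 : 0 < e by near: e; exact: nbhs_right_gt.
  have injp : inj_on (ball (p t) e) by near: e; exact: Finj.
  near=> s.
  have sab : a <= s <= b.
    apply/andP; split; last by near: s; exact: nbhs_right_le.
    by apply: (le_trans at_); near: s; exact: nbhs_right_ge.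
  apply: injp; last exact: Fpq.
    near: s; apply: cvg_within.
    by apply: (pc t tab); exact: nbhsx_ballx.
  near: s; apply: cvg_within; rewrite pqt.
  by apply: (qc t tab); exact: nbhsx_ballx.
- move=> /andP[at_ tb] pqs; have tab : a <= t <= b by rewrite tb ltW.
  have pl : p @ t^'- --> p t by apply: cvg_at_left_filter; exact: pc.
  have ql : q @ t^'- --> q t by apply: cvg_at_left_filter; exact: qc.
  apply: (cvg_unique (@norm_hausdorff _ _) pl); apply: cvg_trans ql; apply: near_eq_cvg.
  near=> s; rewrite pqs//; apply/andP; split.
    by near: s; exact: nbhs_left_ge.
  by near: s; exact: nbhs_left_lt.
Unshelve. all: end_near. Qed.

Lemma branch_eq U1 U2 y a b : inj_on U1 -> open U1 -> inj_on U2 -> open U2 ->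
  a <= b ->
  (forall t, a <= t <= b -> (F @` U1) (t *: y)) ->
  (forall t, a <= t <= b -> (F @` U2) (t *: y)) ->
  branch U1 (a *: y) = branch U2 (a *: y) ->
  branch U1 (b *: y) = branch U2 (b *: y).
Proof.
move=> i1 op1 i2 op2 leab r1 r2.
apply: (lift_unique (p := fun s => branch U1 (s *: y))
  (q := fun s => branch U2 (s *: y)) leab) => t tab.
- exact: branch_ray_continuous (r1 _ tab).
- exact: branch_ray_continuous (r2 _ tab).
- by rewrite (branchP (r1 _ tab)).2 (branchP (r2 _ tab)).2.
Qed.

Definition chart (Z : set V) := [/\ open Z, Z x0, inj_on Z &
  forall x s, Z x -> 0 <= s <= 1 -> (F @` Z) (s *: F x)].

Lemma chart_branch0 Z : chart Z -> branch Z 0 = x0.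
Proof. by move=> [_ Z0 Zi _]; rewrite -F0 branchK. Qed.

(** Both charts contain a lift of the segment from [0] to [F x], and both lifts start at [x0]. This
    makes [F] injective on the union of all charts. *)
Lemma chart_agree Z1 Z2 x y : chart Z1 -> chart Z2 -> Z1 x -> Z2 y ->
  F x = F y -> x = y.
Proof.
move=> c1 c2 Zx Zy Fxy.
have [op1 _ i1 st1] := c1; have [op2 _ i2 st2] := c2.
have := @branch_eq Z1 Z2 (F x) 0 1 i1 op1 i2 op2 ler01.
rewrite scale1r scale0r !chart_branch0// branchK// Fxy branchK//.
by apply => // t t01; [rewrite -Fxy; exact: st1|exact: st2].
Qed.

Definition max_chart := \bigcup_(Z in chart) Z.

(** Take the part, lying over a small ball, of a ball where [F] is injective. The ball in the image
    and the boundedness later control the initial part of every lift. *)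
Lemma small_chart : exists Z r, [/\ chart Z, 0 < r,
  ball 0 r `<=` F @` Z & bounded_set Z].
Proof.
near (0 : R)^'+ => e.
have e0 : 0 < e by near: e; exact: nbhs_right_gt.
have inje : inj_on (ball x0 e) by near: e; exact: Finj.
have := Fopen (nbhsx_ballx x0 e e0).
rewrite F0 => /nbhs_ballP[r /= r0 rF].
exists (ball x0 e `&` F @^-1` (ball 0 r)), r.
have rZ : ball 0 r `<=` F @` (ball x0 e `&` F @^-1` ball 0 r).
  by move=> y ry; have [x ex Fx] := rF y ry; exists x => //; split; rewrite //= Fx.
split=> //; first split.
- apply: openI; first exact: ball_open.
  by apply: open_comp => [x _|]; [exact: Fcont|exact: ball_open].
- by split; [exact: ballxx|rewrite /= F0; exact: ballxx].
- by move=> x y [xe _] [ye _]; exact: inje.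
- move=> x s [_ Fxr] /andP[s0 s1]; apply: rZ; move: Fxr.
  rewrite /= -ball_normE/= !sub0r !normrN normrZ ger0_norm// => Fxr.
  by apply: le_lt_trans Fxr; rewrite ler_piMl.
- exists (`|x0| + e); split; first exact: num_real.
  move=> M leM x [+ _]; rewrite -ball_normE/= => xe.
  rewrite (le_trans _ (ltW leM))// -[x](subKr x0).
  by apply: (le_trans (ler_normB _ _)); rewrite lerD2l ltW.
Unshelve. all: end_near. Qed.

Lemma max_chart_chart : chart max_chart.
Proof.
split.
- by apply: bigcup_open => Z [].
- by have [Z [r [cZ _ _ _]]] := small_chart; exists Z => //; have [] := cZ.
- by move=> x y [Z cZ Zx] [Z' cZ' Zy]; exact: (chart_agree cZ cZ').
- move=> x s [Z cZ Zx] s01; have [_ _ _ star] := cZ.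
  by have [z Zz <-] := star _ _ Zx s01; exists z => //; exists Z.
Qed.

(* A chart is enlarged across a point [z] by the part of a local inverse at [z]
   lying over the cone spanned by a small ball around [F x]. *)
Lemma max_chart_extend z :
  (forall e, 0 < e -> exists x s, [/\ max_chart x, 0 < s <= 1,
     F x = s *: F z & `|x - z| < e]) -> max_chart z.
Proof.
have Zsup : forall Z, chart Z -> Z `<=` max_chart by move=> Z cZ x Zx; exists Z.
move=> hz; have := max_chart_chart.
(* [max_chart] is abstracted to a chart [Z] containing every chart, so a chart through [z] is all
   that has to be built. *)
move: max_chart hz Zsup => Z hz Zmax cZ; have [opZ Z0 injZ starZ] := cZ.
near (0 : R)^'+ => e.
have e0 : 0 < e by near: e; exact: nbhs_right_gt.
have inje : inj_on (ball z e) by near: e; exact: Finj.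
have := Fopen (nbhsx_ballx z e e0) => /nbhs_ballP[r /= r0 rF].
have : nbhs z (ball z e `&` F @^-1` ball (F z) r).
  apply: filterI; first exact: nbhsx_ballx.
  by apply: Fcont; exact: nbhsx_ballx.
move=> /nbhs_ballP[d /= d0 dz]; have [x [s [Zx s01 Fx xz]]] := hz d d0.
have [ez rz] : (ball z e `&` F @^-1` ball (F z) r) x.
  by apply: dz; rewrite -ball_normE/= distrC.
have : nbhs (F x) ((F @` (Z `&` ball z e)) `&` ball (F z) r).
  apply: filterI; first apply: Fopen.
    by apply: open_nbhs_nbhs; split=> //; apply: openI => //; exact: ball_open.
  by apply: open_nbhs_nbhs; split=> //; exact: ball_open.
move=> /nbhs_ballP[h /= h0 hF].
(* The cone of vectors that some contraction towards [0] brings into the small ball around [F x],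
   over which [Z] and the inverse near [z] share points. *)
pose C := [set v | exists2 m : R, 0 < m <= 1 & ball (F x) h (m *: v)].
pose Q := [set u | [/\ ball z e u, ball (F z) r (F u) & C (F u)]].
have between m l v : ball (F z) r (m *: v) -> ball (F z) r v ->
    m <= l <= 1 -> ball (F z) r (l *: v).
  rewrite -!ball_normE/= => rm rv /andP[].
  rewrite le_eqVlt => /orP[/eqP<-//|ml l1].
  have m1 : 0 < 1 - m by lra.
  (* The weight of [v] when [l *: v] is written as a convex combination of [m *: v] and [v]. *)
  pose th := (l - m) / (1 - m).
  have th0 : 0 < th by rewrite divr_gt0//; lra.
  have th1 : th <= 1 by rewrite ler_pdivrMr//; lra.
  have lE : l = (1 - th) * m + th by rewrite /th; field; rewrite gt_eqF.
  clearbody th; have -> : F z - l *: v = (1 - th) *: (F z - m *: v) + th *: (F z - v).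
    rewrite !scalerBr scalerA addrACA -scalerDl subrK scale1r.
    by rewrite -opprD -scalerDl -lE.
  rewrite (le_lt_trans (ler_normD _ _))// !normrZ (gtr0_norm th0).
  rewrite ger0_norm ?subr_ge0//.
  have := ler_wpM2l (_ : 0 <= 1 - th) (ltW rm).
  have := ltr_pM2l th0; move=> /(_ `|F z - v| r); rewrite rv => hv.
  by move=> /(_ _)/= hm; have {}hm := hm ltac:(lra); lra.
suff cZQ : chart (Z `|` Q).
  (* [z] belongs to [Q], because [s] contracts [F z] to [F x]. *)
  apply: (Zmax _ cZQ); right; split; [exact: ballxx|exact: ballxx|].
  by exists s => //; rewrite -Fx; exact: ballxx.
have oQ : open Q.
  rewrite (_ : Q = ball z e `&` F @^-1` (ball (F z) r `&` C)); last first.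
    by apply/seteqP; split=> u /=; [case|case=> ? []].
  apply: openI; first exact: ball_open.
  apply: open_comp => [? _|]; first exact: Fcont.
  apply: openI; first exact: ball_open.
  rewrite (_ : C = \bigcup_(m in [set m : R | 0 < m <= 1])
                     (fun v => m *: v) @^-1` (ball (F x) h)).
    apply: bigcup_open => m _; apply: open_comp; last exact: ball_open.
    by move=> v _; exact: scaler_continuous.
  by apply/seteqP; split=> v /= [m]; exists m.
(* Both inverses are defined over the segment from [m *: F w] to [F w], and at its lower end they
   take the same value, a point of [Z] in the ball around [z]. *)
have ZQ u w : Z u -> Q w -> F u = F w -> u = w.
  move=> Zu [wz wr [m /andP[m0 m1] hm]] Fuw.
  rewrite -(branchK injZ Zu) -(branchK inje wz) Fuw -[F w]scale1r.
  apply: (branch_eq (a := m) injZ opZ inje (ball_open _ _) m1).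
  - by move=> t /andP[mt t1]; rewrite -Fuw; apply: starZ => //; lra.
  - move=> t mt; apply: rF; apply: between mt => //.
    exact: (hF _ hm).2.
  - have [[v [Zv zv] <-] _] := hF _ hm.
    by rewrite !branchK.
split.
- exact: openU.
- by left.
- move=> u w [Zu|Qu] [Zw|Qw] Fuw; [exact: injZ|exact: ZQ|by apply/esym/ZQ|].
  by case: Qu => ? _ _; case: Qw => ? _ _; exact: inje.
- move=> u l [Zu|[uz ur [m /andP[m0 m1] hm]]] /andP[l0 l1].
    by have [|v Zv <-] := starZ u l Zu; [rewrite l0|exists v => //; left].
  (* From the factor [m] upwards the ray stays in the convex ball around [F z]; below [m] the star
     shape of [Z] supplies the preimage. *)
  have [[v [Zv _] Fv] mr] := hF _ hm.
  have [ml|lm] := leP m l.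
    have lr : ball (F z) r (l *: F u) by apply: between mr ur _; rewrite ml.
    have [w zw Fw] := rF _ lr; exists w => //; right; split=> //; rewrite Fw//.
    have lp : 0 < l by lra.
    exists (m / l); first by rewrite divr_gt0//= ler_pdivrMr// mul1r.
    by rewrite scalerA divfK// gt_eqF.
  have [|w Zw Fw] := starZ v (l / m) Zv.
    by rewrite divr_ge0 ?(ltW m0)//= ler_pdivrMr// mul1r ltW.
  by exists w; [left|rewrite Fw Fv scalerA divfK// gt_eqF].
Unshelve. all: end_near. Qed.

End Branches.

(** * Continuation of lifts, and fullness of the largest chart *)

Lemma lipschitz_at_left_cvg (R : realType) (V : completeNormedModType R)
    (g : R -> V) (a t K : R) :
  a < t -> (forall u v, a <= u -> u <= v -> v < t -> `|g v - g u| <= K * (v - u)) ->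
  cvg (g @ t^'-).
Proof.
move=> at_ gK; apply: cauchy_cvg; apply: cauchy_exP => e e0.
have K0 : 0 < `|K| + 1 by rewrite ltr_wpDl.
pose d := e / (`|K| + 1).
have d0 : 0 < d by rewrite divr_gt0.
pose u := Num.max a (t - d).
have ut : u < t by rewrite /u gt_max at_ ltrBlDr ltrDl.
have au : a <= u by rewrite /u le_max lexx.
have tu : t - d <= u by rewrite /u le_max lexx orbT.
exists (g u); suff : \forall v \near t^'-, ball (g u) e (g v) by [].
near=> v.
have uv : u <= v by near: v; exact: nbhs_left_ge.
have vt : v < t by near: v; exact: nbhs_left_lt.
rewrite -ball_normE/= distrC; apply: (le_lt_trans (gK _ _ au uv vt)).
have : K * (v - u) <= `|K| * (v - u) by rewrite ler_wpM2r ?subr_ge0// ler_norm.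
have : `|K| * (v - u) <= `|K| * d by rewrite ler_wpM2l//; lra.
have : (`|K| + 1) * d = e by rewrite /d mulrC divfK// gt_eqF.
by rewrite mulrDl mul1r; lra.
Unshelve. all: end_near. Qed.

Section RayContinuation.
Context {R : realType} {V : completeNormedModType R} {W : normedModType R}.
(** [D x] abstracts the inverse derivative at [x]. [DP] is the first-order expansion of the local
    inverse, with its error measured in the target; [kM] is condition (iii) as a right Dini
    bound. *)
Variables (F : V -> W) (x0 : V) (D : V -> W -> V) (k : V -> R) (M : R).

Hypothesis F0 : F x0 = 0.
Hypothesis Fcont : continuous F.
Hypothesis Finj : forall x, \forall e \near 0^'+, inj_on F (ball x e).
Hypothesis Fopen : forall x U, nbhs x U -> nbhs (F x) (F @` U).
Hypothesis DP : forall (x : V) (e : R), 0 < e ->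
  \forall z \near x, `|z - x - D x (F z - F x)| <= e * `|F z - F x|.
Hypothesis DZ : forall x a w, D x (a *: w) = a *: D x w.
Hypothesis Dbounded : forall r, exists2 C, 0 <= C &
  forall x w, `|x| <= r -> `|D x w| <= C * `|w|.
Hypothesis klip : locally_lipschitz k.
Hypothesis kcoer : coercive k.
Hypothesis M0 : 0 <= M.
Hypothesis kM : forall (x : V) (e : R), 0 < e ->
  \forall h \near 0^'+, k (x - h *: D x (F x)) <= k x + (M + e) * h.

Local Notation Z := (max_chart F x0).
Local Notation G := (branch F Z).

Let cZ : chart F x0 Z := max_chart_chart F0 Fcont Finj Fopen.
Let opZ : open Z := let: And4 h _ _ _ := cZ in h.
Let injZ : inj_on F Z := let: And4 _ _ h _ := cZ in h.

Lemma max_chart_star x s : Z x -> 0 <= s <= 1 -> (F @` Z) (s *: F x).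
Proof. by have [_ _ _] := cZ; apply. Qed.

(** As [u] grows, the lift runs towards [x0]. Passing from [t] to [u] is to first order a step
    [(u - t) / (1 - t)] along [- D p (F p)], so [kM] bounds the slope of [k] by [M / (1 - t)], hence
    by [M / c]. The local Lipschitz property absorbs the first-order error. *)
Lemma branch_dini y (t c e : R) : (F @` Z) ((1 - t) *: y) -> 0 < c <= 1 - t -> 0 < e ->
  \forall u \near t^'+,
    k (G ((1 - u) *: y)) <= k (G ((1 - t) *: y)) + (M / c + e) * (u - t).
Proof.
move=> Zy /andP[c0 ct] e0.
set p := G ((1 - t) *: y).
have t1 : 0 < 1 - t by lra.
have [Zp Fp] : Z p /\ F p = (1 - t) *: y by exact: branchP.
have [d d0 [L kL]] := klip p.
(* Half of [e] pays for the Lipschitz error, through [e1]; the other half pays for [kM], where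
   [e * c / 2] costs at most [e / 2] per unit of [u - t]. *)
pose e1 := e / 2 / (`|L| * `|y| + 1).
have n0 : 0 < `|L| * `|y| + 1 by rewrite ltr_wpDl ?mulr_ge0.
have e10 : 0 < e1 by rewrite !divr_gt0.
have e20 : 0 < e * c / 2 by rewrite divr_gt0 ?mulr_gt0.
have Gt : (fun u => G ((1 - u) *: y)) @ t^'+ --> p.
  apply: cvg_at_right_filter.
  apply: (@continuous_comp R R V (fun u : R => 1 - u) (fun s : R => G (s *: y))).
    by apply: cvgB; [exact: cvg_cst|exact: cvg_id].
  exact: branch_ray_continuous.
have [eta /= eta0 kp] := kM p e20.
near=> u.
set q := G ((1 - u) *: y); set h := (u - t) / (1 - t).
have tu : t < u by near: u; exact: nbhs_right_gt.
have Fq : F q = (1 - u) *: y.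
  have u1 : u <= 1 by near: u; apply: nbhs_right_le; lra.
  have [|w Zw Fw] := @max_chart_star p ((1 - u) / (1 - t)) Zp.
    by rewrite divr_ge0 ?ler_pdivrMr//=; lra.
  have [|//] := @branchP _ _ _ F Z ((1 - u) *: y).
  by exists w => //; rewrite Fw Fp scalerA divfK// gt_eqF.
have Fqp : F q - F p = - (h *: F p).
  rewrite Fq Fp scalerA /h divfK ?gt_eqF// -scalerBl -scaleNr; congr (_ *: _).
  ring.
have qd : `|q - p| < d.
  by rewrite distrC /q; near: u; exact: (cvgr_dist_lt _ _ Gt).
have h0 : 0 < h by rewrite divr_gt0// subr_gt0.
have vd : `|p - h *: D p (F p) - p| < d.
  have w0 : 0 < `|D p (F p)| + 1 by rewrite ltr_wpDl.
  rewrite addrAC subrr sub0r normrN normrZ gtr0_norm//.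
  apply: (@le_lt_trans _ _ (h * (`|D p (F p)| + 1))).
    by rewrite ler_wpM2l ?(ltW h0)//; lra.
  rewrite -ltr_pdivlMr// /h ltr_pdivrMr// ltrBlDl.
  by near: u; apply: nbhs_right_lt; rewrite ltrDl mulr_gt0// divr_gt0.
have kh : k (p - h *: D p (F p)) <= k p + (M + e * c / 2) * h.
  apply: kp => //=; rewrite sub0r normrN gtr0_norm// /h ltr_pdivrMr// ltrBlDl.
  by near: u; apply: nbhs_right_lt; rewrite ltrDl mulr_gt0.
have hq : `|q - (p - h *: D p (F p))| <= e1 * ((u - t) * `|y|).
  have -> : q - (p - h *: D p (F p)) = q - p - D p (F q - F p).
    by rewrite Fqp -[- (h *: F p)]scaleNr DZ scaleNr opprK opprB addrA addrAC.
  have -> : (u - t) * `|y| = `|F q - F p|.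
    rewrite Fq Fp -scalerBl normrZ; congr (_ * _).
    by rewrite (_ : 1 - u - (1 - t) = - (u - t)) ?normrN ?gtr0_norm ?subr_gt0//; ring.
  by rewrite /q; near: u; exact: (Gt _ (DP p e10)).
have kqv : k q - k (p - h *: D p (F p)) <= `|L| * (e1 * ((u - t) * `|y|)).
  apply: (le_trans (ler_norm _)); apply: (le_trans (kL _ _ qd vd)).
  apply: (@le_trans _ _ (`|L| * `|q - (p - h *: D p (F p))|)).
    by rewrite ler_wpM2r// ler_norm.
  by rewrite ler_wpM2l.
have hc : (M + e * c / 2) * h <= (M / c + e / 2) * (u - t).
  rewrite (_ : M / c + e / 2 = (M + e * c / 2) / c); last by field; rewrite gt_eqF.
  rewrite /h mulrA [leRHS]mulrAC ler_wpM2l//; last by rewrite lef_pV2// posrE.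
  by rewrite mulr_ge0// ?subr_ge0 ?(ltW tu)// addr_ge0// ltW.
have Le : `|L| * (e1 * ((u - t) * `|y|)) <= e / 2 * (u - t).
  rewrite (_ : _ * _ = (`|L| * `|y| * e1) * (u - t)); last by ring.
  rewrite ler_wpM2r ?subr_ge0 ?(ltW tu)//.
  by rewrite /e1 mulrA ler_pdivrMr// mulrC ler_wpM2l// ?ltW//; lra.
rewrite [X in _ + X](_ : _ = (M / c + e / 2) * (u - t) + e / 2 * (u - t)).
  lra.
by field; rewrite gt_eqF.
Unshelve. all: end_near. Qed.

(** Integration of [branch_dini]: the parameter [1 - t] runs down from [1] to [s], never below [c],
    over a length of at most [1]. *)
Lemma branch_k_le x c s : Z x -> 0 < c -> c <= s <= 1 ->
  k (G (s *: F x)) <= k x + M / c.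
Proof.
move=> Zx c0 /andP[cs s1].
have Mc : 0 <= M / c by rewrite divr_ge0// ltW.
have := @right_dini_le R (fun t => k (G ((1 - t) *: F x))) 0 (1 - s) (M / c).
rewrite subKr !subr0 scale1r (branchK injZ Zx) => h.
apply: (@le_trans _ _ (k x + M / c * (1 - s))).
  apply: h => //; first by rewrite subr_ge0.
  - move=> t /andP[t0 ts].
    apply: (@continuous_comp R V R (fun t : R => G ((1 - t) *: F x)) k); last first.
      exact: kcoer.1.
    apply: (@continuous_comp R R V (fun u : R => 1 - u)
      (fun s : R => G (s *: F x))).
      by apply: cvgB; [exact: cvg_cst|exact: cvg_id].
    apply: (branch_ray_continuous Fopen injZ opZ).
    by apply: max_chart_star => //; lra.
  - move=> t /andP[t0 ts] e e0; apply: branch_dini => //; last by lra.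
    by apply: max_chart_star => //; lra.
by rewrite lerD2l ler_piMr//; lra.
Qed.

(** At a point [p] the lift has velocity [D p y], of norm at most [C] times that of [y] while the
    lift stays in the ball of radius [r]. *)
Lemma branch_lipschitz y r C a b : a <= b -> 0 <= C ->
  (forall x w, `|x| <= r -> `|D x w| <= C * `|w|) ->
  (forall t, a <= t <= b -> (F @` Z) (t *: y) /\ `|G (t *: y)| <= r) ->
  `|G (b *: y) - G (a *: y)| <= C * `|y| * (b - a).
Proof.
move=> leab C0 DC Zr.
apply: (@mean_value_le _ _ (fun t => G (t *: y))) => //; first by rewrite mulr_ge0.
move=> t tab e e0; have [Zt rt] := Zr t tab.
have [Zp Fp] := branchP Zt.
set p := G (t *: y) in rt Zp Fp *.
pose e1 := e / (`|y| + 1).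
have n0 : 0 < `|y| + 1 by rewrite ltr_wpDl.
have e10 : 0 < e1 by rewrite divr_gt0.
have Gt : (fun s => G (s *: y)) @ t --> p by exact: branch_ray_continuous.
have Zn : \forall s \near t, (F @` Z) (s *: y).
  apply: (@scalel_continuous R W y t); rewrite -Fp; apply: Fopen.
  exact: open_nbhs_nbhs.
near=> s.
have [_ Fq] : Z (G (s *: y)) /\ F (G (s *: y)) = s *: y.
  by apply: branchP; near: s.
set q := G (s *: y) in Fq *.
have : `|q - p - D p (F q - F p)| <= e1 * `|F q - F p|.
  by rewrite /q; near: s; exact: (Gt _ (DP p e10)).
have := DC p (F q - F p) rt.
have -> : `|F q - F p| = `|s - t| * `|y| by rewrite Fq Fp -scalerBl normrZ.
move=> h1 h2; rewrite -[q - p](subrK (D p (F q - F p))).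
apply: (le_trans (ler_normD _ _)); apply: (le_trans (lerD h2 h1)).
have : e1 * `|y| <= e.
  by rewrite /e1 mulrAC ler_pdivrMr// ler_wpM2l ?(ltW e0)//; lra.
move=> /(ler_wpM2r (normr_ge0 (s - t))); lra.
Unshelve. all: end_near. Qed.

(** The ray is cut at [s = c]: above it [branch_k_le] and coercivity bound the lift, below it the
    small chart does. *)
Lemma branch_bounded_near (x : V) : exists r : R, \forall z \near x,
  Z z -> forall s, 0 <= s <= 1 -> `|G (s *: F z)| <= r.
Proof.
have [Z1 [rho [cZ1 rho0 rhoZ [r1 [_ Zr1]]]]] := small_chart F0 Fcont Finj Fopen.
have n0 : 0 < `|F x| + 1 + rho by rewrite addr_gt0// ltr_wpDl.
(* Near [x] the norm of [F z] is at most that of [F x] plus [1], so [s < c] puts [s *: F z] in the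
   ball of radius [rho]. *)
pose c := rho / (`|F x| + 1 + rho).
have c0 : 0 < c by rewrite divr_gt0.
(* Near [x] one has [k z <= k x + 1]; the second unit makes the contradiction strict. *)
have [r2 kr2] := kcoer.2 (k x + 2 + M / c).
exists (Num.max (r1 + 1) r2); near=> z => Zz s /andP[s0 s1].
rewrite le_max.
have [cs|sc] := leP c s.
  apply/orP; right; rewrite leNgt; apply/negP => /ltW/kr2.
  have kz : k z <= k x + 1.
    have : `|k x - k z| <= 1 by near: z; apply: (cvgr_dist_le _ _ (kcoer.1 x)).
    by move=> /ler_normlP[]; lra.
  have := @branch_k_le z c s Zz c0; rewrite cs s1 => /(_ isT); lra.
apply/orP; left.
have Fz : `|F z| <= `|F x| + 1.
  have : `|F x - F z| <= 1 by near: z; exact: (cvgr_dist_le _ _ (@Fcont x)).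
  rewrite distrC -[F z in X in _ -> X](subrK (F x)) => h.
  by rewrite (le_trans (ler_normD _ _))// addrC lerD2l.
have [|u Zu <-] := rhoZ (s *: F z).
  rewrite -ball_normE/= sub0r normrN normrZ ger0_norm//.
  apply: (@le_lt_trans _ _ (c * (`|F x| + 1))); first by rewrite ler_pM// ltW.
  by rewrite /c mulrAC ltr_pdivrMr// ltr_pM2l// ltrDl.
rewrite branchK//; last by exists Z1.
by apply: Zr1 => //; lra.
Unshelve. all: end_near. Qed.

Lemma max_chart_closed : closed Z.
Proof.
move=> x clx; have [r0 hr0] := branch_bounded_near x.
have [C C0 DC] := Dbounded (r0 + 1).
(* The uniform bound passes from points [z] of [Z] to their limit [x] by continuity of [G] at
   [s *: F x], at the cost of [1]. *)
have near_Z s : 0 <= s <= 1 -> (F @` Z) (s *: F x) ->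
    `|G (s *: F x)| <= r0 + 1.
  move=> s01 [w Zw Fw].
  have Gs : (fun z => G (s *: F z)) @ x --> G (s *: F x).
    apply: (@continuous_comp V W V (fun z => s *: F z) G).
      by apply: cvgZr; exact: Fcont.
    by apply: branch_continuous => //; exists w.
  have : \forall z \near x, `|G (s *: F x) - G (s *: F z)| <= 1.
    exact: (cvgr_dist_le _ _ Gs).
  move=> /(filterI hr0)/clx[z [Zz [/(_ Zz s s01) h1 h2]]].
  rewrite -[G (s *: F x)](subrK (G (s *: F z))).
  by rewrite (le_trans (ler_normD _ _))// addrC lerD.
(* Once a point [w] of [Z] lies over [F x], the values [G (F z)] tend to [w]; for [z] in [Z] they
   equal [z], which tends to [x]. *)
suff [w Zw Fw] : (F @` Z) (1 *: F x).
  rewrite scale1r in Fw.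
  suff -> : x = w by [].
  apply/eqP; rewrite -subr_eq0 -normr_le0; apply/ler_addgt0Pr => e e0.
  have Gx : (fun z => G (F z)) @ x --> w.
    rewrite -(branchK injZ Zw) Fw.
    apply: (@continuous_comp V W V F G); first exact: Fcont.
    by apply: branch_continuous => //; exists w.
  have : \forall z \near x, `|w - G (F z)| <= e / 2.
    by apply: (cvgr_dist_le _ _ Gx); rewrite divr_gt0.
  have : \forall z \near x, `|x - z| <= e / 2.
    apply/nbhs_ballP; exists (e / 2) => [|z]; rewrite /= ?divr_gt0//.
    by rewrite -ball_normE => /ltW.
  move=> /filterI h /h/clx[z [Zz []]]; rewrite branchK// => xz wz.
  rewrite add0r -[x](subrK z) -addrA (le_trans (ler_normD _ _))//.
  by rewrite (distrC z w); lra.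
have := @real_induction R 0 1 (fun s => (F @` Z) (s *: F x)) ler01.
move=> /(_ _ _ _ 1); rewrite ler01 lexx; apply=> //.
- by have [_ Zx0 _ _] := cZ; exists x0 => //; rewrite scale0r.
- move=> t _ [w Zw Fw]; apply: cvg_within.
  apply: (@scalel_continuous R W (F x) t); rewrite -Fw; apply: Fopen.
  exact: open_nbhs_nbhs.
(* The lift is Lipschitz before [t], so it has a left limit [z], with [F z = t *: F x]. Its values
   are points of [Z] on the ray of [F z] arbitrarily close to [z], as [max_chart_extend]
   requires. *)
- move=> t /andP[t0 t1] Zs.
  have gcvg : cvg ((fun s : R => G (s *: F x)) @ t^'-).
    apply: (@lipschitz_at_left_cvg _ _ _ 0 t (C * `|F x|)) => // u v u0 uv vt.
    apply: (branch_lipschitz uv C0 DC) => s /andP[us sv].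
    have Zx : (F @` Z) (s *: F x) by apply: Zs; lra.
    by split=> //; apply: near_Z => //; lra.
  have /cvg_ex[z gz] := gcvg.
  have Fz : F z = t *: F x.
    have Fg : F (G (s *: F x)) @[s --> t^'-] --> F z.
      by apply: continuous_cvg gz; exact: Fcont.
    apply: (cvg_unique (@norm_hausdorff _ _) Fg).
    have : (fun s : R => s *: F x) @ t^'- --> t *: F x.
      by apply: cvg_at_left_filter; exact: scalel_continuous.
    apply: cvg_trans; apply: near_eq_cvg; near=> s => /=.
    have Zx : (F @` Z) (s *: F x).
      apply: Zs; apply/andP; split; last by near: s; exact: nbhs_left_lt.
      by near: s; exact: nbhs_left_ge.
    by rewrite (branchP Zx).2.
  exists z => //; apply: (max_chart_extend F0 Fcont Finj Fopen) => e e0.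
  near t^'- => s.
  have s0 : 0 < s by near: s; exact: nbhs_left_gt.
  have st : s < t by near: s; exact: nbhs_left_lt.
  have [Zg Fg] : Z (G (s *: F x)) /\ F (G (s *: F x)) = s *: F x.
    by apply: branchP; apply: Zs; lra.
  exists (G (s *: F x)), (s / t); split=> //.
  + by rewrite divr_gt0//= ler_pdivrMr// mul1r ltW.
  + by rewrite Fz scalerA divfK// gt_eqF.
  + by rewrite distrC; near: s; exact: (cvgr_dist_lt _ _ gz).
Unshelve. all: end_near. Qed.

(** [Z] is open, closed and contains [x0]; real induction along the segment from [x0] to [x]
    replaces connectedness. *)
Lemma max_chart_full x : Z x.
Proof.
have seg t : {for t, continuous (fun t : R => x0 + t *: (x - x0))}.
  by apply: cvgD; [exact: cvg_cst|exact: scalel_continuous].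
have := @real_induction R 0 1 (fun s => Z (x0 + s *: (x - x0))) ler01.
move=> /(_ _ _ _ 1); rewrite ler01 lexx scale0r scale1r addr0.
rewrite (addrC x0 (x - x0)) subrK.
apply=> //.
- by have [_ Zx0 _ _] := cZ.
- move=> t _ Zt; apply: cvg_within; apply: (seg t).
  exact: open_nbhs_nbhs.
- move=> t /andP[t0 t1] Zs.
  have segl := cvg_at_left_filter (seg t).
  apply: (closed_cvg Z max_chart_closed _ _ segl).
  near=> s; apply: Zs; apply/andP; split; last by near: s; exact: nbhs_left_lt.
  by near: s; exact: nbhs_left_ge.
Unshelve. all: end_near. Qed.

End RayContinuation.

(** * Operator norms and strict differentiability *)

Section Operators.
Context {R : realType} {V W : normedModType R}.

Lemma linear_bound (L : {linear V -> W}) : continuous L ->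
  exists2 C, 0 <= C & forall v, `|L v| <= C * `|v|.
Proof.
move=> Lc; have /linear_boundedP Lb := continuous_linear_bounded 0 (Lc 0).
near (+oo : set_system R) => C; exists C.
  by near: C; exact: nbhs_pinfty_ge.
by near: C.
Unshelve. all: end_near. Qed.

(** The supremum in [opnorm] is informative only for a bounded set. The maximum with [0] covers a
    negative [C]. *)
Lemma opnorm_ubound (L : V -> W) C : (forall v, `|L v| <= C * `|v|) ->
  has_ubound [set `|L v| | v in [set v | `|v| <= 1]].
Proof.
move=> LC; exists (Num.max C 0) => _ [v /= v1 <-].
apply: (le_trans (LC v)); apply: (@le_trans _ _ (Num.max C 0 * `|v|)).
  by rewrite ler_wpM2r// le_max lexx.
by rewrite ler_piMr// le_max lexx orbT.
Qed.

Lemma opnorm_ge (L : {linear V -> W}) v : continuous L ->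
  `|L v| <= opnorm L * `|v|.
Proof.
move=> /linear_bound[C _ LC].
have [->|v0] := eqVneq v 0; first by rewrite linear0 !normr0 mulr0.
rewrite -ler_pdivrMr ?normr_gt0//.
apply: ub_le_sup; first exact: opnorm_ubound LC.
exists (`|v|^-1 *: v); first by rewrite /= normrZ normfV normr_id mulVf ?normr_eq0.
by rewrite linearZ/= normrZ normfV normr_id mulrC.
Qed.

Lemma opnorm_le (L : V -> W) C : 0 <= C -> (forall v, `|L v| <= C * `|v|) ->
  opnorm L <= C.
Proof.
move=> C0 LC; apply: ge_sup => [|_ [v /= v1 <-]].
  by exists `|L 0|, 0 => //=; rewrite normr0.
by apply: (le_trans (LC v)); rewrite ler_piMr.
Qed.

Lemma opnorm_ge0 (L : V -> W) C : (forall v, `|L v| <= C * `|v|) -> 0 <= opnorm L.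
Proof.
move=> LC; apply: (@le_trans _ _ `|L 0|) => //.
apply: ub_le_sup; first exact: opnorm_ubound LC.
by exists 0 => //=; rewrite normr0.
Qed.

(** Two-sided inverses are unique, so the map chosen by [inv_map] is the continuous linear one. *)
Lemma inv_mapP (L : {linear V -> W}) : is_isom L -> exists g : {linear W -> V},
  [/\ inv_map L = g, cancel L g, cancel g L & continuous g].
Proof.
move=> [_ [g [Lg gL gc]]]; exists g; split=> //.
apply: get_unique => // h [Lh hL].
by apply/funext => w; rewrite -[in LHS](gL w) Lh.
Qed.

Lemma diff_near (f : V -> W) x e : differentiable f x -> 0 < e ->
  \forall z \near x, `|f z - f x - 'd f x (z - x)| <= e * `|z - x|.
Proof.
move=> /diff_locally/eqaddoP/(_ e) fx e0.
rewrite (near_shift 0 x) subr0; near=> h.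
rewrite /= addrK.
have : `|(f \o shift x - (cst (f x) + 'd f x)) h| <= e * `|h|.
  by near: h; exact: fx.
by rewrite /= !fctE/= opprD addrA.
Unshelve. all: end_near. Qed.

Lemma diff_of_near (f : V -> W) x (T : {linear V -> W}) : continuous T ->
  (forall e, 0 < e -> \forall z \near x, `|f z - f x - T (z - x)| <= e * `|z - x|) ->
  differentiable f x /\ 'd f x = T :> (V -> W).
Proof.
move=> Tc fT.
have fE : f \o shift x = cst (f x) + T +o_ 0 id.
  apply/eqaddoP => e e0; have := fT e e0.
  rewrite (near_shift 0 x) subr0; apply: filterS => h.
  by rewrite /= addrK !fctE/= opprD addrA.
have dE := diff_unique Tc fE.
by split=> //; apply/diff_locallyP; rewrite dE.
Qed.

Lemma C1_diff_bound (f : V -> W) x e : C1 f -> 0 < e ->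
  \forall z \near x, forall v, `|'d f z v - 'd f x v| <= e * `|v|.
Proof.
move=> [df cf] e0; near=> z => v.
have := @opnorm_ge ('d f z \- 'd f x) v.
move=> h; apply: (le_trans (h _)) => {h}.
  by move=> u; apply: cvgB; exact: (diff_continuous (df _)).
rewrite ler_wpM2r//; apply: (le_trans (ler_norm _)).
rewrite -normrN -sub0r; near: z.
exact: (cvgr_dist_le _ _ (cf x)).
Unshelve. all: end_near. Qed.

(** Strict differentiability: the mean value inequality for [f] minus its linear part at [x], along
    a segment on which the derivative stays within [e] of ['d f x]. *)
Lemma C1_strict (f : V -> W) x e : C1 f -> 0 < e ->
  \forall d \near 0^'+, forall u v, ball x d u -> ball x d v ->
    `|f u - f v - 'd f x (u - v)| <= e * `|u - v|.
Proof.
move=> fC1 e0; have /nbhs_ballP[d0 /= d00 hd] := C1_diff_bound x fC1 e0.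
near=> d => u v ud vd.
have dd0 : d < d0 by near: d; exact: nbhs_right_lt.
pose p (t : R) := v + t *: (u - v).
pose h t := f (p t) - t *: 'd f x (u - v).
have -> : f u - f v - 'd f x (u - v) = h 1 - h 0.
  by rewrite /h /p !scale1r !scale0r addr0 subr0 (addrC v) subrK addrAC.
have := @mean_value_le R W h 0 1 (e * `|u - v|) ler01.
rewrite subr0 mulr1; apply; first by rewrite mulr_ge0// ltW.
move=> t /andP[t0 t1] r r0.
have pd : ball x d0 (p t).
  move: ud vd; rewrite -!ball_normE/= => ud vd.
  have -> : x - p t = t *: (x - u) + (1 - t) *: (x - v).
    rewrite /p scalerBl scale1r addrCA -scalerBr.
    have -> : x - u - (x - v) = v - u by rewrite opprB addrC addrA subrK.
    by rewrite opprD addrA -scalerN opprB.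
  apply: (le_lt_trans (ler_normD _ _)); rewrite !normrZ !ger0_norm ?subr_ge0//.
  have := ler_wpM2l t0 (ltW ud).
  have := ler_wpM2l (_ : 0 <= 1 - t) (ltW vd).
  by rewrite subr_ge0 => /(_ t1); lra.
have n0 : 0 < `|u - v| + 1 by rewrite ltr_wpDl.
pose r1 := r / (`|u - v| + 1).
have r10 : 0 < r1 by rewrite divr_gt0.
have pc : p @ t --> p t.
  by apply: cvgD; [exact: cvg_cst|exact: scalel_continuous].
near=> s.
have pst : p s - p t = (s - t) *: (u - v).
  by rewrite /p opprD addrACA subrr add0r scalerBl.
have h1 : `|f (p s) - f (p t) - 'd f (p t) (p s - p t)| <= r1 * `|p s - p t|.
  by near: s; exact: (pc _ (diff_near (fC1.1 _) r10)).
have h2 : `|'d f (p t) (p s - p t) - 'd f x (p s - p t)| <= e * `|p s - p t|.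
  exact: (hd _ pd).
have -> : h s - h t = (f (p s) - f (p t) - 'd f (p t) (p s - p t))
    + ('d f (p t) (p s - p t) - 'd f x (p s - p t)).
  rewrite addrA subrK pst linearZ/= scalerBl /h.
  by rewrite opprD opprK addrACA opprB (addrC (t *: _)).
apply: (le_trans (ler_normD _ _)); apply: (le_trans (lerD h1 h2)).
rewrite pst normrZ.
have : r1 * `|u - v| <= r.
  by rewrite /r1 mulrAC ler_pdivrMr// ler_wpM2l ?(ltW r0)//; lra.
move=> /(ler_wpM2r (normr_ge0 (s - t))); lra.
Unshelve. all: end_near. Qed.

End Operators.

(** * Local injectivity, openness, and expansion of the local inverse *)

Section InverseFunction.
Context {R : realType} {V : completeNormedModType R} {W : normedModType R}.
Variables (f : V -> W).
Hypothesis fC1 : C1 f.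
Hypothesis fisom : forall x, is_isom ('d f x).

Lemma inv_bound x : exists2 C, 0 < C &
  forall w, `|inv_map ('d f x) w| <= C * `|w|.
Proof.
have [g [-> _ _ /linear_bound[C C0 gC]]] := inv_mapP (fisom x).
exists (C + 1) => [|w]; first by rewrite ltr_wpDl.
by apply: (le_trans (gC w)); rewrite ler_wpM2r// lerDl.
Qed.

Lemma C1_inj_near x : \forall d \near 0^'+, inj_on f (ball x d).
Proof.
have [C C0 hC] := inv_bound x.
(* With this tolerance, equal values of [f] force the distance from [u] to [v] to be at most half of
   itself. *)
have e0 : 0 < (2 * C)^-1 by rewrite invr_gt0 mulr_gt0.
near=> d => u v ud vd fuv.
have st : forall u v, ball x d u -> ball x d v ->
    `|f u - f v - 'd f x (u - v)| <= (2 * C)^-1 * `|u - v|.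
  by near: d; exact: C1_strict.
have := st u v ud vd; rewrite fuv subrr sub0r normrN => h.
have [g [gE Lg _ _]] := inv_mapP (fisom x).
have := hC ('d f x (u - v)); rewrite gE Lg => h2.
have : `|u - v| <= C * ((2 * C)^-1 * `|u - v|).
  by apply: (le_trans h2); rewrite ler_wpM2l// ltW.
rewrite mulrA invfM mulrCA mulfV ?gt_eqF// mulr1 => h3.
by apply/eqP; rewrite -subr_eq0 -normr_le0; lra.
Unshelve. all: end_near. Qed.

(** Solutions of [f u = y] are the fixed points of the simplified Newton map [T], which contracts a
    closed ball into itself when [y] is close to [f x]. *)
Lemma C1_open_near x U : nbhs x U -> nbhs (f x) (f @` U).
Proof.
move=> /nbhs_ballP[r /= r0 rU].
have [C C0 hC] := inv_bound x.
have e0 : 0 < (2 * C)^-1 by rewrite invr_gt0 mulr_gt0.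
have [g [gE Lg gL _]] := inv_mapP (fisom x); rewrite gE in hC.
near (0 : R)^'+ => d'.
have d'0 : 0 < d' by near: d'; exact: nbhs_right_gt.
have d'r : d' < r by near: d'; exact: nbhs_right_lt.
have st : forall u v, ball x d' u -> ball x d' v ->
    `|f u - f v - 'd f x (u - v)| <= (2 * C)^-1 * `|u - v|.
  by near: d'; exact: C1_strict.
pose d := d' / 2.
have d0 : 0 < d by rewrite divr_gt0.
have dd' : d < d' by rewrite /d; lra.
pose B : set V := closed_ball_ Num.norm x d.
have BB u : B u -> ball x d' u.
  by rewrite -ball_normE/= => Bu; exact: (le_lt_trans Bu).
have Bx : B x by rewrite /B /closed_ball_ /= subrr normr0 ltW.
(* This radius puts [T x] within [d / 2] of [x]; the contraction by one half adds at most [d / 2],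
   so [T] preserves [B]. *)
apply/nbhs_ballP; exists (d / (2 * C)) => [|y]; first by rewrite /= divr_gt0 ?mulr_gt0.
rewrite -ball_normE/= => yd.
pose T u := u - g (f u - y).
have Tlip u v : B u -> B v -> `|T u - T v| <= 2^-1 * `|u - v|.
  move=> Bu Bv.
  have -> : T u - T v = - g (f u - f v - 'd f x (u - v)).
    have gB : g (f u - y) - g (f v - y) = g (f u - f v).
      by rewrite -(linearB g) opprB addrA subrK.
    rewrite (linearB g) Lg -gB /T; move: (g (f u - y)) (g (f v - y)) => a b.
    by rewrite [RHS]opprB !opprB (addrC b (- v)) addrACA (addrC (- a)).
  rewrite normrN (le_trans (hC _))//.
  have := ler_wpM2l (ltW C0) (st u v (BB _ Bu) (BB _ Bv)).
  by rewrite mulrA invfM mulrCA mulfV ?gt_eqF// mulr1.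
have Tx : `|T x - x| <= d / 2.
  rewrite /T addrAC subrr sub0r normrN (le_trans (hC _))//.
  have := ler_wpM2l (ltW C0) (ltW yd).
  by rewrite invfM mulrCA (mulrCA C) mulfV ?gt_eqF// mulr1.
have TB : {homo T : u / B u >-> B u}.
  move=> u Bu; rewrite /B /closed_ball_/=.
  have := Tlip _ _ Bu Bx; rewrite distrC => h.
  rewrite -(subrKA (T x)) (le_trans (ler_normD _ _))//.
  have : 2^-1 * `|u - x| <= 2^-1 * d by rewrite ler_wpM2l// distrC.
  rewrite (distrC x); lra.
have [|||p Bp pT] := @banach_fixed_point _ _ B (mkfun TB).
- exists (2^-1)%:nng; split=> /=; first by lra.
  by move=> [u v] [/= Bu Bv]; exact: Tlip.
- exact: closed_closed_ball_.
- by exists x.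
exists p.
  by apply: rU; have := BB _ Bp; rewrite -!ball_normE/= => h; exact: (lt_trans h).
have g0 : g (f p - y) = 0.
  apply/oppr_inj; rewrite oppr0; apply: (addrI p); rewrite addr0; exact: esym pT.
by apply/eqP; rewrite -subr_eq0 -[f p - y]gL g0 linear0.
Unshelve. all: end_near. Qed.

Lemma C1_inv_near x e : 0 < e -> \forall z \near x,
  `|z - x - inv_map ('d f x) (f z - f x)| <= e * `|f z - f x|.
Proof.
move=> e0; have [C C0 hC] := inv_bound x.
have [g [gE Lg gL _]] := inv_mapP (fisom x); rewrite gE in hC *.
(* The first bound makes [C * n] at most one half, so [z - x] is controlled by [2 * C] times the
   increment of [f]; the second then brings the error down to [e] times that increment. *)
pose n := Num.min (2 * C)^-1 (e / (2 * C ^+ 2)).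
have n0 : 0 < n by rewrite lt_min invr_gt0 divr_gt0 ?mulr_gt0 ?exprn_gt0.
near=> z.
have h : `|f z - f x - 'd f x (z - x)| <= n * `|z - x|.
  by near: z; exact: (diff_near (fC1.1 x)).
have h1 : `|z - x - g (f z - f x)| <= C * n * `|z - x|.
  rewrite -normrN opprB -[X in `|_ - X|]Lg -linearB/= (le_trans (hC _))//.
  by rewrite -mulrA ler_wpM2l// ltW.
have h2 : `|g (f z - f x)| <= C * `|f z - f x| by [].
have Cn1 : C * n <= 2^-1.
  have : C * n <= C * (2 * C)^-1 by rewrite ler_wpM2l ?(ltW C0)// ge_min lexx.
  by rewrite invfM mulrCA mulfV ?gt_eqF// mulr1.
have Cn2 : C * n <= e / (2 * C).
  have : C * n <= C * (e / (2 * C ^+ 2)).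
    by rewrite ler_wpM2l ?(ltW C0)// ge_min lexx orbT.
  by rewrite (_ : C * (e / _) = e / (2 * C)) //; field; rewrite gt_eqF.
have h3 : `|z - x| <= 2 * C * `|f z - f x|.
  have : `|z - x| <= `|z - x - g (f z - f x)| + `|g (f z - f x)|.
    by rewrite -[in leLHS](subrK (g (f z - f x)) (z - x)) ler_normD.
  have := ler_wpM2r (normr_ge0 (z - x)) Cn1; lra.
apply: (le_trans h1); apply: (le_trans (ler_wpM2r _ Cn2)) => //.
rewrite -[leRHS](_ : e / (2 * C) * (2 * C * `|f z - f x|) = _).
  by rewrite ler_wpM2l// divr_ge0 ?(ltW e0)// mulr_ge0// ltW.
by field; rewrite gt_eqF.
Unshelve. all: end_near. Qed.

End InverseFunction.

(** * Directional derivatives, the global inverse, and the conclusion *)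

Lemma rdirder_le_near (R : realType) (V : normedModType R) (k : V -> R)
    (x v : V) (M e : R) : has_rdirder k -> rdirder k x v <= M -> 0 < e ->
  \forall h \near 0^'+, k (x + h *: v) <= k x + (M + e) * h.
Proof.
move=> kd kM e0; near=> h.
have h0 : 0 < h by near: h; exact: nbhs_right_gt.
have : (k (x + h *: v) - k x) / h <= M + e.
  near: h; apply: (cvgr_le _ (kd x v)).
  by apply: (le_lt_trans kM); rewrite ltrDl.
by rewrite ler_pdivrMr// lerBlDl.
Unshelve. all: end_near. Qed.

Section Diffeo.
Context {R : realType} {V : completeNormedModType R} {W : normedModType R}.
Variables (f : V -> W).
Hypothesis fC1 : C1 f.
Hypothesis fisom : forall x, is_isom ('d f x).
Hypothesis invb : forall r : R, 0 < r -> exists M : R, forall x : V, `|x| <= r ->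
  opnorm (inv_map ('d f x)) <= M.

Lemma inv_locally_bounded r : exists2 C, 0 <= C &
  forall x w, `|x| <= r -> `|inv_map ('d f x) w| <= C * `|w|.
Proof.
(* [r] is arbitrary here, while [invb] takes a positive radius. *)
have [|M hM] := invb (r := `|r| + 1); first by rewrite ltr_wpDl.
exists `|M| => // x w xr.
have {hM} : opnorm (inv_map ('d f x)) <= M.
  by apply: hM; apply: (le_trans xr); rewrite (le_trans (ler_norm r))// lerDl.
have [g [-> _ _ gc]] := inv_mapP (fisom x) => gM.
apply: (le_trans (opnorm_ge w gc)); rewrite ler_wpM2r//.
exact: (le_trans gM (ler_norm M)).
Qed.

(** The inverse is the branch over the whole space. [C1_inv_near] gives its derivative, whose
    continuity rests on A^-1 - B^-1 = A^-1 (B - A) B^-1. *)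
Lemma injective_diffeo : injective f -> global_diffeo_onto_range f.
Proof.
move=> finj.
have injT : inj_on f setT by move=> x y _ _; exact: finj.
have Gf x : branch f setT (f x) = x by exact: branchK.
have fop := C1_open_near fC1 fisom.
have Gcvg x : branch f setT @ f x --> x.
  by apply: branch_cvg => //; exact: openT.
have rn x : \forall y \near f x, range f y.
  by apply: fop; exact: filterT.
have dG x : differentiable (branch f setT) (f x) /\
    'd (branch f setT) (f x) = inv_map ('d f x) :> (W -> V).
  have [g [gE _ _ gc]] := inv_mapP (fisom x); rewrite gE.
  apply: diff_of_near => // e e0; near=> y; rewrite -gE Gf.
  have : `|branch f setT y - x - inv_map ('d f x) (f (branch f setT y) - f x)|
      <= e * `|f (branch f setT y) - f x|.
    near: y; exact: (Gcvg x _ (C1_inv_near fC1 fisom x e0)).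
  have [z _ <-] : range f y by near: y; exact: rn.
  by rewrite Gf.
split=> //.
  rewrite openE => _ [x _ <-]; exact: rn.
exists (branch f setT); split=> //; split=> _ [x _ <-]; first exact: (dG x).1.
(* The radius leaves room for the preimages [u] of points near [f x], so that one [C] bounds both
   inverse derivatives. *)
have [C C0 DC] := inv_locally_bounded (`|x| + 1).
have n0 : 0 < C * C + 1 by rewrite ltr_wpDl// mulr_ge0.
apply/cvgrPdist_le => e e0; near=> y.
have [u _ uy] : range f y by near: y; exact: rn.
have ux : `|u| <= `|x| + 1.
  have : `|x - branch f setT y| <= 1.
    by near: y; exact: (cvgr_dist_le _ _ (Gcvg x)).
  rewrite -uy Gf distrC => h.
  by rewrite -[u](subrK x) addrC (le_trans (ler_normD _ _))// lerD2l.
(* The two inverse factors cost [C * C], so this tolerance leaves at most [e]; the [+ 1] guards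
   against [C = 0]. *)
have Au v : `|'d f u v - 'd f x v| <= e / (C * C + 1) * `|v|.
  rewrite -(Gf u) uy; move: v; near: y.
  exact: (Gcvg x _ (C1_diff_bound x fC1 (divr_gt0 e0 n0))).
have bd w : `|('d (branch f setT) y \- 'd (branch f setT) (f x)) w| <= e * `|w|.
  rewrite /= -uy !(dG _).2.
  have hu := DC u _ ux.
  have hx : `|inv_map ('d f x) w| <= C * `|w| by apply: DC; rewrite lerDl.
  have [g [gE _ gL _]] := inv_mapP (fisom x).
  have [g' [gE' Lg' gL' _]] := inv_mapP (fisom u).
  rewrite gE gE' in hu hx *.
  have -> : g' w - g w = - g' ('d f u (g w) - 'd f x (g w)).
    by rewrite linearB/= Lg' gL opprB.
  rewrite normrN (le_trans (hu _))//.
  apply: (@le_trans _ _ (C * (e / (C * C + 1) * (C * `|w|)))).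
    rewrite ler_wpM2l// (le_trans (Au _))// ler_wpM2l//.
    by rewrite divr_ge0 ?(ltW e0)// ltW.
  rewrite [leLHS](_ : _ = (e * (C * C) / (C * C + 1)) * `|w|); last first.
    by field; rewrite gt_eqF.
  by rewrite ler_wpM2r// ler_pdivrMr// ler_wpM2l ?(ltW e0)// lerDl.
rewrite sub0r normrN ger0_norm; last exact: opnorm_ge0 bd.
by apply: opnorm_le; first exact: ltW.
Unshelve. all: end_near. Qed.

End Diffeo.

Theorem theorem2p1 (R : realType) (X Y : completeNormedModType R) (f : X -> Y)
    (x0 : X) (k : X -> R) :
  C1 f ->
  (forall x, is_isom ('d f x)) ->
  (forall r : R, 0 < r -> exists M : R, forall x : X, `|x| <= r ->
      opnorm (inv_map ('d f x)) <= M) ->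
  (forall x, 0 <= k x) -> locally_lipschitz k -> coercive k -> has_rdirder k ->
  (exists M : R, forall x : X,
      rdirder k x (- inv_map ('d f x) (f x - f x0)) <= M) ->
  global_diffeo_onto_range f /\
  (forall y s, range f y -> 0 <= s <= 1 -> range f (f x0 + s *: (y - f x0))).
Proof.
move=> fC1 fisom invb _ klip kcoer kd [M kM].
(* Translation turns star shape about [f x0] into star shape about [0]. *)
pose F x := f x - f x0.
have FB x z : F z - F x = f z - f x by rewrite /F opprB addrA subrK.
have F0 : F x0 = 0 by rewrite /F subrr.
have Fcont : continuous F.
  move=> x; apply: cvgB; last exact: cvg_cst.
  exact: (differentiable_continuous (fC1.1 x)).
have Finj x : \forall e \near 0^'+, inj_on F (ball x e).
  apply: filterS (C1_inj_near fC1 fisom x) => e injf u v ue ve /addIr.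
  exact: injf.
have Fopen x U : nbhs x U -> nbhs (F x) (F @` U).
  move=> xU.
  have sh : (fun y : Y => y + f x0) @ F x --> f x.
    by rewrite -[f x](subrK (f x0)); apply: cvgD; [exact: cvg_id|exact: cvg_cst].
  have : \forall y \near F x, (f @` U) (y + f x0).
    exact: (sh _ (C1_open_near fC1 fisom xU)).
  apply: filterS => y [z Uz fz].
  by exists z => //; rewrite /F fz addrK.
have DP (x : X) (e : R) : 0 < e -> \forall z \near x,
    `|z - x - inv_map ('d f x) (F z - F x)| <= e * `|F z - F x|.
  move=> e0; apply: filterS (C1_inv_near fC1 fisom x e0) => z.
  by rewrite FB.
have DZ x a w : inv_map ('d f x) (a *: w) = a *: inv_map ('d f x) w.
  by have [g [-> _ _ _]] := inv_mapP (fisom x); rewrite linearZ.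
(* [M] may be negative, whereas the continuation argument takes a nonnegative bound. *)
have M0 : 0 <= `|M| by [].
have kF (x : X) (e : R) : 0 < e -> \forall h \near 0^'+,
    k (x - h *: inv_map ('d f x) (F x)) <= k x + (`|M| + e) * h.
  move=> e0; have kMx := le_trans (kM x) (ler_norm M).
  by apply: filterS (rdirder_le_near kd kMx e0) => h; rewrite scalerN.
have full := max_chart_full F0 Fcont Finj Fopen DP DZ
  (inv_locally_bounded fisom invb) klip kcoer M0 kF.
(* The largest chart is the whole space, so its injectivity and star shape hold for all of [F]. *)
have [_ _ Zinj Zstar] := max_chart_chart F0 Fcont Finj Fopen.
split.
  apply: injective_diffeo => // x y fxy.
  by apply: Zinj => //; rewrite /F fxy.
move=> _ s [x _ <-] s01; have [z _ Fz] := Zstar x s (full x) s01.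
by exists z => //; rewrite -/(F x) -Fz /F addrC subrK.
Qed.
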